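(* Let $X$ and $Y$ be nonempty compact convex metrizable subsets of locally convex spaces and let $f\colon X\to Y$ be a continuous affine open map. Then the map $\mathrm{cc}(f)\colon\mathrm{cc}(X)\to\mathrm{cc}(Y)$ is soft.
   Context: All topological spaces are assumed to be Tychonov (so locally convex spaces are Hausdorff) and all maps are continuous. For a space $X$, $\exp X$ is the set of all nonempty compact subsets of $X$ with the Vietoris topology, whose base consists of the sets $\langle U_1,\dots,U_n\rangle=\{A\in\exp X\mid A\subset U_1\cup\dots\cup U_n,\ A\cap U_i\neq\emptyset\text{ for every }i\}$, with $U_1,\dots,U_n$ open in $X$, $n\in\mathbb N$. For a compact convex subset $X$ of a locally convex space, $\mathrm{cc}(X)=\{A\in\exp X\mid A\text{ is convex}\}$ with the subspace topology. For a continuous affine map $f\colon X\to Y$ between compact convex subsets of locally convex spaces, $\mathrm{cc}(f)\colon\mathrm{cc}(X)\to\mathrm{cc}(Y)$ is given by $\mathrm{cc}(f)(A)=f(A)$. A map $f\colon X\to Y$ is soft if for every paracompact space $Z$, every closed subset $A\subset Z$, and all maps $\psi\colon A\to X$ and $\varphi\colon Z\to Y$ with $f\psi=\varphi|A$, there exists a map $\Phi\colon Z\to X$ such that $\Phi|A=\psi$ and $f\Phi=\varphi$. *)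

(* Defs.v *)
From HB Require Import structures.
From mathcomp Require Import all_boot all_order all_algebra.
From mathcomp Require Import all_classical all_reals all_analysis.

Set Implicit Arguments.
Unset Strict Implicit.
Unset Printing Implicit Defensive.

Import Order.TTheory GRing.Theory Num.Theory.
Import numFieldNormedType.Exports.

Local Open Scope classical_set_scope.
Local Open Scope ring_scope.
Local Open Scope convex_scope.

Definition metrizable (R : realType) (T : topologicalType) : Prop :=
  exists (M : metricType R) (h : T -> M) (g : M -> T),
    [/\ cancel h g, cancel g h, continuous h & continuous g].

Definition locally_finite (T : topologicalType) (U : set (set T)) : Prop :=
  forall x : T, exists2 V, nbhs x V & finite_set [set A | U A /\ A `&` V !=set0].

(* The Hausdorff axiom is part of the definition; such spaces are normal, hence
   Tychonov. *)
Definition paracompact_space (T : topologicalType) : Prop :=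
  hausdorff_space T /\
  forall U : set (set T), U `<=` open -> cover U id = [set: T] ->
    exists W : set (set T),
      [/\ W `<=` open, cover W id = [set: T],
          forall B, W B -> exists2 A, U A & B `<=` A
        & locally_finite W].

Definition open_map (X Y : topologicalType) (f : X -> Y) : Prop :=
  forall U : set X, open U -> open (f @` U).

Definition soft (X Y : topologicalType) (f : X -> Y) : Prop :=
  forall (Z : topologicalType) (A : set Z) (psi : A -> X) (phi : Z -> Y),
    paracompact_space Z -> closed A -> continuous psi -> continuous phi ->
    f \o psi = phi \o set_val ->
    exists Phi : Z -> X,
      [/\ continuous Phi, Phi \o set_val = psi & f \o Phi = phi].

Record hyperspace (X : topologicalType) : Type := Hyperspace {
  hyperspace_set :> set X ;
  hyperspace_neq0 : hyperspace_set !=set0 ;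
  hyperspace_compact : compact hyperspace_set }.

Section vietoris.
Context {X : topologicalType}.

HB.instance Definition _ := gen_eqMixin (hyperspace X).
HB.instance Definition _ := gen_choiceMixin (hyperspace X).

(* <U_1, ..., U_n>, the U_i being given as a family of sets; the empty family
   yields the empty set. *)
Definition vietoris (U : set (set X)) : set (hyperspace X) :=
  [set A | (A : set X) `<=` cover U id /\
           forall B, U B -> (A : set X) `&` B !=set0].

Definition vietoris_index : set (set (set X)) :=
  [set U | finite_set U /\ U `<=` open].

Lemma vietoris_cover : \bigcup_(U in vietoris_index) vietoris U = setT.
Proof.
apply/seteqP; split => // A _; exists [set [set: X]].
  by split=> [|B ->]; [exact: finite_set1|exact: openT].
split=> [x _|B ->]; first by exists setT.
by rewrite setIT; exact: hyperspace_neq0.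
Qed.

Lemma vietoris_join U V A : vietoris_index U -> vietoris_index V ->
  vietoris U A -> vietoris V A ->
  exists W, [/\ vietoris_index W, vietoris W A &
                vietoris W `<=` vietoris U `&` vietoris V].
Proof.
move=> [finU oU] [finV oV] [AU mU] [AV mV].
exists ([set B `&` cover V id | B in U] `|` [set B `&` cover U id | B in V]).
split.
- split; first by rewrite finite_setU; split; exact: finite_image.
  by move=> _ [] [B ?] <-; apply: openI;
    [exact: oU|exact: bigcup_open|exact: oV|exact: bigcup_open].
- split=> [x Ax|_ [] [B UB <-]].
  + have [B UB Bx] := AU _ Ax.
    exists (B `&` cover V id); first by left; exists B.
    by split => //; exact: AV.
  + by have [x [Ax Bx]] := mU _ UB; exists x; split=> //; split=> //; exact: AV.
  + by have [x [Ax Bx]] := mV _ UB; exists x; split=> //; split=> //; exact: AU.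
- move=> C [CW mW]; split; split.
  + by move=> x /CW [_ [] [B ? <-]] [] // ? ?; exists B.
  + move=> B UB; have [|x [Cx [Bx _]]] := mW (B `&` cover V id).
      by left; exists B.
    by exists x.
  + by move=> x /CW [_ [] [B ? <-]] [] // ? ?; exists B.
  + move=> B VB; have [|x [Cx [Bx _]]] := mW (B `&` cover U id).
      by right; exists B.
    by exists x.
Qed.

HB.instance Definition _ := isBaseTopological.Build (hyperspace X)
  vietoris_cover vietoris_join.

End vietoris.

Section hyperspace_map.
Context {X Y : topologicalType} (f : X -> Y) (cf : continuous f).

Lemma hyperspace_map_neq0 (A : hyperspace X) : f @` A !=set0.
Proof. by have [x Ax] := hyperspace_neq0 A; exists (f x); exists x. Qed.

Lemma hyperspace_map_compact (A : hyperspace X) : compact (f @` A).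
Proof.
apply: continuous_compact; last exact: hyperspace_compact.
exact: continuous_subspaceT.
Qed.

Definition hyperspace_map (A : hyperspace X) : hyperspace Y :=
  Hyperspace (hyperspace_map_neq0 A) (@hyperspace_map_compact A).

End hyperspace_map.

(* As a type, cc X carries the subspace topology inherited from hyperspace X. *)
Definition cc (R : realType) (E : tvsType R) (X : set E) : set (hyperspace X) :=
  [set A : hyperspace X |
    convex_set (set_val @` (A : set X) : set (convex_lmodType E))].

Arguments cc {R E} X _.

Section cc_map.
Context {R : realType} {E F : tvsType R} {X : set E} {Y : set F}.

(* When X is convex, z below ranges over all convex combinations of x and y. *)
Definition affine_map (f : X -> Y) : Prop :=
  forall (x y z : X) (t : {i01 R}),
    set_val z = (set_val x : convex_lmodType E) <| t |> set_val y ->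
    set_val (f z) = (set_val (f x) : convex_lmodType F) <| t |> set_val (f y).

Variable f : X -> Y.
Hypotheses (cf : continuous f) (af : affine_map f).

Lemma cc_map_convex (A : cc X) :
  hyperspace_map cf (set_val A) \in cc Y.
Proof.
rewrite inE => _ _ t /set_mem[_ [a Aa <-] <-] /set_mem[_ [b Ab <-] <-].
have cA : cc X (set_val A) by apply/set_mem; exact: (valP A).
have := cA (set_val a) (set_val b) t.
move=> /(_ (mem_set (imageP _ Aa)) (mem_set (imageP _ Ab))) /set_mem[c Ac ce].
apply/mem_set; exists (f c); first by exists c.
exact: af.
Qed.

Definition cc_map (A : cc X) : cc Y :=
  exist _ (hyperspace_map cf (set_val A)) (cc_map_convex A).

End cc_map.

(* Main.v *)
From HB Require Import structures.
Require Import Defs.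
From mathcomp Require Import all_boot all_order all_algebra.
From mathcomp Require Import all_classical all_reals all_analysis.
From mathcomp Require Import ring lra.

Set Implicit Arguments.
Unset Strict Implicit.
Unset Printing Implicit Defensive.

Import Order.TTheory GRing.Theory Num.Theory.
Import numFieldNormedType.Exports.

Local Open Scope classical_set_scope.
Local Open Scope ring_scope.

(** The proof is a direct construction. Let [A] be closed in the paracompact
    space [Z], and let [psi : A -> cc X] and [phi : Z -> cc Y] be given with
    [f (psi a) = phi a]; a continuous [Phi : Z -> cc X] with [f (Phi z) = phi z]
    that extends [psi] is required.

    A compact convex metrizable subset [X] of a locally convex space carries a
    continuous metric [d] that is the Minkowski functional of the difference of
    its arguments ([exists_convex_metric]), so that the distance function of a
    compact convex subset of [X] is convex and 1-Lipschitz. The function sending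
    [(a, x)] to the distance from [x] to [psi a] is continuous on the closed
    subset [A * X] of [Z * X]. As the product of a paracompact and a compact
    space, [Z * X] is paracompact, hence normal, and Tietze's theorem extends
    this function to [Z * X]. Replacing the extension, for each [z], by its
    largest convex 1-Lipschitz minorant gives functions [k z] on [X], depending
    continuously on [z] for the sup-norm, that are convex and still equal to the
    distance to [psi a] for [z = a] ([extend_dist]).

    The map [f] is onto, since its image is open and closed in the connected set
    [Y]; since [f] is open and [X] is compact, its fibres vary continuously for
    the Hausdorff distance ([fibre_closeP]). Therefore, if [A'] is a compact
    convex set with [f (A')] equal to [phi z] and [w] is near [z], then the part
    of the preimage of [phi w] that is close to [A'] is a compact convex set,
    close to [A'], whose image is [phi w] ([lifts_transfer]). Consequently the
    sup-norm distance [defect z] from [k z] to the distance functions of compact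
    convex sets lying exactly over [phi z] is continuous in [z] ([near_defect]),
    and it vanishes on [A]. Finally
      [Phi z = {x | f x in phi z and k z x <= 2 * defect z}].
    This is compact and convex, its image is [phi z], and it is [psi z] on [A].
    Its graph is closed, which gives upper semicontinuity. Lower semicontinuity
    has two cases. Where [defect z > 0], each fibre over [phi z] contains a
    strict solution of the inequality, and moving a given solution slightly
    towards it, by convexity of [k z] inside the fibre, makes room for small
    changes of [z] ([section_lsc_gt0]). Where [defect z = 0], [k z] is itself
    the distance to [Phi z], and for [w] near [z] a convex set over [phi w] whose
    distance function is close to [k w] passes near every point of [Phi z]
    ([section_lsc_eq0]). *)

(** * Compactness and the Vietoris topology *)

Lemma near_finite_forall {I : Type} {J : choiceType} (F : set_system I)
    (V : set J) (P : J -> set I) : Filter F ->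
  finite_set V -> (forall j, V j -> \forall i \near F, P j i) ->
  \forall i \near F, forall j, V j -> P j i.
Proof.
move=> FF finV VP; apply: filterS (@filter_bigI _ _ (fset_set V) P F FF _).
  by move=> i Pi j Vj; apply: Pi; rewrite /= in_fset_set//; exact: mem_set.
by move=> j; rewrite in_fset_set// => /set_mem; exact: VP.
Qed.

(** The tube lemma, for an arbitrary filter in place of the neighbourhoods of a
    point. *)
Lemma compact_near_forall {I : Type} {X : topologicalType} (F : set_system I)
    (P : I -> X -> Prop) : Filter F -> compact [set: X] ->
  (forall x : X, \forall x' \near x & i \near F, P i x') ->
  \forall i \near F, forall x, P i x.
Proof.
move=> FF /compact_near_coveringP cX FP.
by apply: filterS (cX _ F P FF (fun x _ => FP x)) => i Pi x; exact: Pi.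
Qed.

Section vietoris_topology.
Context {X : topologicalType}.

Lemma hyperspace_ext (A B : hyperspace X) :
  (A : set X) = (B : set X) -> A = B.
Proof.
case: A B => [A nA cA] [B nB cB] /= AB; case: _ / AB nB cB => nB cB.
by congr Hyperspace; exact: Prop_irrelevance.
Qed.

Lemma open_vietoris (U : set (set X)) : vietoris_index U -> open (vietoris U).
Proof.
move=> vU; exists [set U]; first by move=> _ ->.
by rewrite bigcup_set1.
Qed.

Lemma vietoris_nbhs (A : hyperspace X) (P : set (hyperspace X)) :
  nbhs A P -> exists U, [/\ vietoris_index U, vietoris U A & vietoris U `<=` P].
Proof.
rewrite nbhsE => -[Q [[D Dv <-] [U DU UA]] QP].
by exists U; split => // [|B UB]; [exact: Dv|apply: QP; exists U].
Qed.

Lemma near_hyperspace_sub (A : hyperspace X) (U : set X) :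
  open U -> A `<=` U -> \forall B \near A, hyperspace_set B `<=` U.
Proof.
move=> oU AU; have vU : vietoris_index [set U].
  by split => [|_ ->//]; exact: finite_set1.
apply: (@filterS _ _ _ (vietoris [set U])) => [B [BU _] x /BU|].
  by case=> _ ->.
apply: open_nbhs_nbhs; split; first exact: open_vietoris.
split => [x Ax|_ ->]; first by exists U => //; exact: AU.
by have [x Ax] := hyperspace_neq0 A; exists x; split => //; exact: AU.
Qed.

Lemma near_hyperspace_meet (A : hyperspace X) (U : set X) :
  open U -> A `&` U !=set0 -> \forall B \near A, hyperspace_set B `&` U !=set0.
Proof.
move=> oU AU; have vU : vietoris_index [set U; setT].
  split=> [|_ [] ->//]; last exact: openT.
  by rewrite finite_setU; split; exact: finite_set1.
apply: (@filterS _ _ _ (vietoris [set U; setT])) => [B [_]|].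
  by apply; left.
apply: open_nbhs_nbhs; split; first exact: open_vietoris.
split => [x Ax|_ [] -> //]; first by exists setT => //; right.
by rewrite setIT; exact: hyperspace_neq0.
Qed.

(** A basic Vietoris neighbourhood is a finite conjunction of one containment
    condition and finitely many hitting conditions, so continuity splits into
    upper and lower semicontinuity. *)
Lemma hyperspace_cvg {Z : topologicalType} (S : Z -> hyperspace X) (z : Z) :
  (forall U : set X, open U -> S z `<=` U -> \forall w \near z, S w `<=` U) ->
  (forall U : set X, open U -> S z `&` U !=set0 ->
    \forall w \near z, S w `&` U !=set0) ->
  {for z, continuous S}.
Proof.
move=> usc lsc P /vietoris_nbhs [V [[finV oV] [SV mV] VP]].
have hit : \forall w \near z, forall B, V B -> S w `&` B !=set0.
  by apply: near_finite_forall => // B VB; apply: lsc; [exact: oV|exact: mV].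
near=> w; apply: VP; split; last by near: w; exact: hit.
by near: w; apply: usc SV; apply: bigcup_open.
Unshelve. all: by end_near. Qed.

(** Vietoris-close compact sets are Hausdorff-close, for any relation [r]
    containing a neighbourhood of the diagonal in place of a bound on distances:
    sets [B] near [A] stay inside the neighbourhoods [V x] of the points [x] of
    [A] and, by compactness of [A], meet enough of them. *)
Lemma near_hyperspace_rel (r : X -> X -> Prop) (A : hyperspace X) :
  (forall x : X, exists V : set X, nbhs x V /\ forall y y', V y -> V y' -> r y y') ->
  \forall B \near A,
    (forall x, (A : set X) x -> exists2 y, hyperspace_set B y & r x y) /\
    (forall y, hyperspace_set B y -> exists2 x, (A : set X) x & r x y).
Proof.
move=> /choice[V Vr].
have Vx x : nbhs x (V x) by have [] := Vr x.
have rV x y y' : V x y -> V x y' -> r y y' by have [_] := Vr x; exact.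
apply: filterI.
  have /compact_near_coveringP Acov := @hyperspace_compact X A.
  apply: (Acov _ (nbhs A)
    (fun B x => exists2 y, hyperspace_set B y & r x y) (nbhs_filter A)) => a Aa.
  exists (V a, fun B => hyperspace_set B `&` interior (V a) !=set0) => /=.
    split; first exact: Vx.
    apply: near_hyperspace_meet; first exact: open_interior.
    by exists a; split => //; exact: Vx.
  move=> [b C] /= [Vb [c [Cc /interior_subset Vc]]].
  by exists c => //; exact: (rV a).
have oO : open (\bigcup_(x in A) interior (V x)).
  by apply: bigcup_open => x _; exact: open_interior.
apply: filterS (near_hyperspace_sub oO _) => [B BO y /BO[x Ax /interior_subset Vy]|x Ax].
  by exists x => //; apply: (rV x) => //; exact: nbhs_singleton.
by exists x => //; exact: Vx.
Qed.

End vietoris_topology.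

(** * Paracompact spaces *)

Section paracompact.
Context {T : topologicalType}.

(** Only finitely many members of [W] come near [x], so a neighbourhood of [x]
    can be shrunk to avoid them one by one. *)
Lemma locally_finite_closure (W : set (set T)) (x : T) :
  locally_finite W -> (forall B, W B -> ~ closure B x) ->
  ~ closure (cover W id) x.
Proof.
move=> /(_ x) [V Vx finV] Wx clx.
have miss : \forall y \near x, forall B, (W B /\ B `&` V !=set0) -> ~ B y.
  apply: (near_finite_forall (P := fun B y => ~ B y) _ finV) => B [WB _].
  have : nbhs x (~` closure B).
    by apply: open_nbhs_nbhs; split;
      [exact/closed_openC/closed_closure|exact/Wx].
  by apply: filterS => y ncl /subset_closure.
have [y [[B WB By] [Vy mB]]] := clx _ (filterI Vx miss).
by apply: (mB B) => //; split => //; exists y.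
Qed.

Lemma locally_finite_sub (W W' : set (set T)) :
  W' `<=` W -> locally_finite W -> locally_finite W'.
Proof.
move=> W'W lW x; have [V Vx finV] := lW x; exists V => //.
by apply: sub_finite_set finV => B [/W'W].
Qed.

(** In a paracompact space the neighbourhoods of the points of a closed set [C]
    whose closures avoid [D] can be glued: those members of a locally finite
    refinement which meet [C] have a union whose closure avoids [D]. *)
Lemma paracompact_separate (C D : set T) :
  paracompact_space T -> closed C ->
  (forall c, C c -> exists U, [/\ open U, U c & closure U `&` D = set0]) ->
  exists U, [/\ open U, C `<=` U & closure U `&` D = set0].
Proof.
move=> [_ pT] cC CD.
pose U := [set V | open V /\ closure V `&` D = set0] `|` [set ~` C].
have Uo : U `<=` open by move=> V [[]|->] //; exact: closed_openC.
have Uc : cover U id = [set: T].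
  rewrite -subTset => x _; have [Cx|nCx] := pselect (C x).
    by have [V [oV Vx VD]] := CD x Cx; exists V => //; left.
  by exists (~` C) => //; right.
have [W [Wo Wc WU lW]] := pT U Uo Uc.
pose W' := [set B | W B /\ B `&` C !=set0].
exists (cover W' id); split.
- by apply: bigcup_open => B [/Wo].
- move=> x Cx; have : cover W id x by rewrite Wc.
  by move=> [B WB Bx]; exists B => //; split => //; exists x.
- rewrite -subset0 => x [clx Dx]; move: clx.
  apply: locally_finite_closure; first by apply: locally_finite_sub lW => B [].
  move=> B [WB [c [Bc Cc]]] clB; have [V [[oV VD]|->]] := WU B WB.
    by move=> /closureS /(_ _ clB) clV; have : set0 x by rewrite -VD.
  by move=> /(_ c Bc).
Qed.

(** [paracompact_separate] is used twice: with a point as [D] it yields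
    regularity, which is its hypothesis when [D] is an arbitrary closed set. *)
Lemma paracompact_normal (R : realType) :
  paracompact_space T -> normal_space T.
Proof.
move=> pT; have [hT _] := pT; apply/(@normal_openP R) => A B cA cB AB0.
have regular (C : set T) x : closed C -> ~ C x ->
    exists U, [/\ open U, C `<=` U & closure U `&` [set x] = set0].
  move=> cC nCx; apply: paracompact_separate => // c Cc.
  have /eqP cx : c <> x by move=> cx; apply: nCx; rewrite -cx.
  move: hT; rewrite open_hausdorff => /(_ _ _ cx).
  move=> [[U V] /= [/set_mem Uc /set_mem Vx] [oU oV /eqP UV0]].
  exists U; split => //; rewrite -subset0 => u /= [+ ux]; rewrite {u}ux => clU.
  have [y UVy] := clU V (open_nbhs_nbhs (conj oV Vx)).
  by move: UVy; rewrite UV0.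
have [|U [oU AU UB]] := @paracompact_separate A B pT cA.
  move=> a Aa; have nBa : ~ B a by move=> Ba; have : set0 a by rewrite -AB0.
  have [V [oV BV Va]] := regular B a cB nBa.
  exists (~` closure V); split.
  - exact/closed_openC/closed_closure.
  - by move=> cVa; have : set0 a by rewrite -Va.
  - rewrite -subset0 => x [] /[swap] Bx.
    have /closureS : ~` closure V `<=` ~` V by apply/subsetC/subset_closure.
    by move=> /[apply]; rewrite -(closure_id _).1; [apply; exact: BV|exact: open_closedC].
exists U, (~` closure U); split => //.
- exact/closed_openC/closed_closure.
- by move=> x Bx clU; have : set0 x by rewrite -UB.
- by rewrite -subset0 => x [/subset_closure].
Qed.

End paracompact.

(** The product of a paracompact space with a compact one is paracompact: by the
    tube lemma, every fibre [[set z] `*` setT] has a neighbourhood [V `*` setT]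
    covered by finitely many members of the given cover, and a locally finite
    refinement of these [V]'s can be cut up accordingly. *)
Lemma paracompact_prod_compact (Z X : topologicalType) :
  paracompact_space Z -> hausdorff_space X -> compact [set: X] ->
  paracompact_space (Z * X)%type.
Proof.
move=> [hZ pZ] hX cX; split.
  move=> [z x] [w y] clzx; congr pair.
    apply: hZ => P Q Pz Qw.
    have [[u v] /= [[Pu _] [Qu _]]] : (P `*` [set: X]) `&` (Q `*` [set: X]) !=set0.
      by apply: clzx; [exists (P, setT)|exists (Q, setT)] => //; split => //=;
        exact: filterT.
    by exists u.
  apply: hX => P Q Px Qy.
  have [[u v] /= [[_ Pu] [_ Qu]]] : ([set: Z] `*` P) `&` ([set: Z] `*` Q) !=set0.
    by apply: clzx; [exists (setT, P)|exists (setT, Q)] => //; split => //=;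
      exact: filterT.
  by exists v.
move=> O oO cO.
pose tube V F := [/\ finite_set F, F `<=` O & V `*` [set: X] `<=` cover F id].
pose U := [set V : set Z | open V /\ exists F, tube V F].
have Uc : cover U id = [set: Z].
  rewrite -subTset => z _.
  (* Along [Ffin], every finite subfamily of [O] is eventually included. *)
  pose Ffin := filter_from [set F | finite_set F /\ F `<=` O]
    (fun F => [set G | F `<=` G]).
  have FF : Filter Ffin.
    apply: filter_from_filter; first by exists set0; split => //; exact: finite_set0.
    move=> F G [finF FO] [finG GO]; exists (F `|` G).
      by rewrite /= finite_setU; split => //; rewrite subUset.
    by move=> H /=; rewrite subUset.
  have /compact_near_coveringP/(_ _ (filter_prod (nbhs z) Ffin)
      (fun i x => cover i.2 id (i.1, x)) _) := cX.
  move=> [|[P Q] /= [Pz [F [finF FO] FQ]] PQ].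
    move=> x _; have [G OG Gzx] : cover O id (z, x) by rewrite cO.
    have [[P Q] /= [Pz Qx] PQG] : nbhs (z, x) G.
      by apply: open_nbhs_nbhs; split => //; exact: oO.
    exists (Q, [set i | P i.1 /\ i.2 G]).
      split => //; exists (P, [set F | F G]) => //=; split => //.
      exists [set G]; last by move=> F /(_ G erefl).
      by split => [|_ ->//]; exact: finite_set1.
    move=> [x' [z' F]] /= [Qx' [Pz' FG]]; exists G => //.
    by apply: PQG; split.
  exists P°; last exact: Pz.
  split; first exact: open_interior.
  exists F; split => // -[w x] /= [Pw _].
  apply: (PQ (w, F)) => //; split => /=; first exact: interior_subset.
  exact: FQ.
have [W [Wo Wc WU lW]] := pZ U (fun V UV => UV.1) Uc.
have tubeW B : exists F, W B -> tube B F.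
  have [WB|nWB] := pselect (W B); last by exists set0.
  have [V [_ [F [finF FO VF]]] BV] := WU B WB.
  by exists F; split => // -[w x] [/BV Vw _]; exact: VF.
have [F WF] := choice tubeW.
exists (\bigcup_(B in W) [set (B `*` setT) `&` G | G in F B]); split.
- move=> _ [B WB [G FG <-]]; apply: openI; last first.
    by have [_ FO _] := WF B WB; exact/oO/FO.
  by rewrite openE => -[z x] [/= Bz _]; exists (B, setT) => //; split => //=;
    [apply: open_nbhs_nbhs; split => //; exact: Wo|exact: filterT].
- rewrite -subTset => -[z x] _.
  have [B WB Bz] : cover W id z by rewrite Wc.
  have [_ _ /(_ (z, x))[//|G FG Gzx]] := WF B WB.
  by exists ((B `*` setT) `&` G) => //; exists B => //; exists G.
- move=> _ [B WB [G FG <-]]; have [_ FO _] := WF B WB.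
  by exists G; [exact: FO|move=> ? []].
- move=> [z x]; have [V Vz finV] := lW z.
  exists (V `*` setT); first by exists (V, setT) => //; split => //=; exact: filterT.
  apply: (@sub_finite_set _ _ (\bigcup_(B in [set B | W B /\ B `&` V !=set0])
    [set (B `*` setT) `&` G | G in F B])).
    move=> _ [[B WB [G FG <-]] [[w u] [[[Bw _] _] [Vw _]]]].
    by exists B; [split => //; exists w|exists G].
  apply: bigcup_finite => // B [WB _]; apply: finite_image.
  by have [] := WF B WB.
Qed.

(** * Convex metrics *)

Local Open Scope convex_scope.

(** Continuous metrics that behave like a norm with respect to the convex
    combinations [c]. Everything about a compact convex set that matters later
    is expressed through [c] and such a metric, without the ambient vector
    space. *)
Record convex_metric (R : realType) (T : topologicalType)
    (c : {i01 R} -> T -> T -> T) (d : T -> T -> R) : Prop := ConvexMetric {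
  cmetricxx : forall x, d x x = 0 ;
  cmetric_sym : forall x y, d x y = d y x ;
  cmetric_triangle : forall y x z, d x z <= d x y + d y z ;
  cmetric_eq0 : forall x y, d x y = 0 -> x = y ;
  cmetric_continuous : continuous (fun p : T * T => d p.1 p.2) ;
  cmetric_conv : forall t x y a b,
    d (c t x y) (c t a b) <= t%:num * d x a + (1 - t%:num) * d y b }.

Section gauge.
Context {R : realType} {E : lmodType R} (W : set (convex_lmodType E)).
Hypotheses (cvxW : convex_set W) (W0 : W 0).
Implicit Types u v : E.

Let G v : set R := [set t | 0 < t /\ W (t^-1 *: v)].

(** The Minkowski functional; it is only meaningful on the vectors that [W]
    absorbs. *)
Definition gauge v : R := inf (G v).

Lemma convex_setE (A : set (convex_lmodType E)) : convex_set A ->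
  forall (t : R) x y, 0 <= t -> t <= 1 -> A x -> A y ->
    A (t *: x + (1 - t) *: y).
Proof.
move=> cA t x y t0 t1 Ax Ay.
have /set_mem := cA x y (Itv01 t0 t1) (mem_set Ax) (mem_set Ay).
by [].
Qed.

Lemma convex_set0Z (A : set (convex_lmodType E)) : convex_set A -> A 0 ->
  forall (t : R) x, 0 <= t -> t <= 1 -> A x -> A (t *: x).
Proof.
move=> cA A0 t x t0 t1 Ax.
by have := convex_setE cA t0 t1 Ax A0; rewrite scaler0 addr0.
Qed.

Let Glb v : has_lbound (G v).
Proof. by exists 0 => t [/ltW]. Qed.

Lemma gauge_ge0 v : 0 <= gauge v.
Proof.
rewrite /gauge; have [->|/set0P G0] := eqVneq (G v) set0; first by rewrite inf0.
by apply: lb_le_inf => // t [/ltW].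
Qed.

Lemma gauge_le v t : 0 < t -> W (t^-1 *: v) -> gauge v <= t.
Proof. by move=> t0 Wt; apply: ge_inf. Qed.

Lemma gauge_lt v t : W v -> gauge v < t -> 0 < t /\ W (t^-1 *: v).
Proof.
move=> Wv vt; have Gv : G v 1 by split; rewrite ?invr1 ?scale1r.
have [s [s0 Ws] st] := inf_lt (ex_intro _ _ Gv) vt.
have t0 : 0 < t by exact: lt_trans st.
split => //; have -> : t^-1 *: v = (s / t) *: (s^-1 *: v).
  by rewrite scalerA mulrAC divff ?mul1r// gt_eqF.
apply: convex_set0Z => //; first by rewrite divr_ge0// ltW.
by rewrite ler_pdivrMr// mul1r ltW.
Qed.

(** Sublinearity. Membership in [W] of [l *: u + m *: v], divided by
    [l * a + m * b], follows from convexity of [W] with weight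
    [l * a / (l * a + m * b)]. *)
Lemma gauge_comb (l m : R) u v : 0 <= l -> 0 <= m -> 0 < l + m -> W u -> W v ->
  gauge (l *: u + m *: v) <= l * gauge u + m * gauge v.
Proof.
move=> l0 m0 lm0 Wu Wv; apply/ler_addgt0Pr => e e0.
have d0 : 0 < e / (l + m) by rewrite divr_gt0.
have [] := @gauge_lt u (gauge u + e / (l + m)) Wu; first by rewrite ltrDl.
set a := _ + _ => a0 Wa.
have [] := @gauge_lt v (gauge v + e / (l + m)) Wv; first by rewrite ltrDl.
set b := _ + _ => b0 Wb.
have -> : l * gauge u + m * gauge v + e = l * a + m * b.
  by rewrite /a /b; field; rewrite gt_eqF.
have s0 : 0 < l * a + m * b.
  move: l0; rewrite le_eqVlt => /predU1P[l0|l0].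
    by rewrite -l0 mul0r add0r mulr_gt0//; move: lm0; rewrite -l0 add0r.
  by rewrite ltr_wpDr ?mulr_gt0 ?mulr_ge0// ltW.
apply: gauge_le => //.
have la0 : 0 <= l * a by rewrite mulr_ge0// ltW.
have mb0 : 0 <= m * b by rewrite mulr_ge0// ltW.
have := @convex_setE _ cvxW (l * a / (l * a + m * b)) _ _ _ _ Wa Wb.
rewrite !scalerA scalerDr !scalerA.
have -> : l * a / (l * a + m * b) / a = (l * a + m * b)^-1 * l.
  by field; rewrite !gt_eqF.
have -> : (1 - l * a / (l * a + m * b)) / b = (l * a + m * b)^-1 * m.
  by field; rewrite !gt_eqF.
apply; first by rewrite divr_ge0// ltW.
by rewrite ler_pdivrMr// mul1r lerDl.
Qed.

End gauge.

Section set_type_topology.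
Context {X : topologicalType}.
Implicit Types A : set X.

Lemma set_type_nbhs A (x : A) (P : set A) :
  nbhs x P <-> exists2 Q, nbhs (set_val x) Q & set_val @^-1` Q `<=` P.
Proof.
split=> [[_ /= [[Q oQ <-] Qx QP]]|[Q Qx QP]].
  by exists Q => //; exact: open_nbhs_nbhs.
by apply: filterS QP _; exact: (@initial_continuous A X set_val).
Qed.

Lemma set_type_continuous (Y : topologicalType) A (g : Y -> A) (y : Y) :
  {for y, continuous (set_val \o g)} -> {for y, continuous g}.
Proof. by move=> cg P /set_type_nbhs [Q Qy QP]; apply: filterS QP _; exact: cg. Qed.

Lemma set_type_compact A : compact A -> compact [set: A].
Proof.
move=> cA F PF _; have [|x [Ax Fx]] := cA (set_val @ F) _.
  by rewrite nbhs_simpl /=; apply: nearW => a; exact: set_valP.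
exists (exist _ x (mem_set Ax)); split => // P Q FP /set_type_nbhs [V Vx VQ].
have [|y [[a Pa <-] Vy]] := Fx (set_val @` P) V _ Vx.
  by rewrite nbhs_simpl /=; apply: (@filterS _ _ _ P) => // a Pa; exists a.
by exists a; split => //; exact: VQ.
Qed.

Lemma set_type_hausdorff A : hausdorff_space X -> hausdorff_space A.
Proof.
move=> hX x y xy; apply: val_inj; apply: hX => P Q Px Qy.
have [||z [Pz Qz]] := xy (set_val @^-1` P) (set_val @^-1` Q).
- by apply/set_type_nbhs; exists P.
- by apply/set_type_nbhs; exists Q.
- by exists (set_val z).
Qed.

End set_type_topology.

Section convex_metric_exists.
Context {R : realType} {E : tvsType R} {X : set E}.
Hypotheses (hE : hausdorff_space E) (cptX : compact X) (cvxX : convex_set X).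

Definition conv_set (t : {i01 R}) (x y : X) : X :=
  exist _ ((set_val x : convex_lmodType E) <| t |> set_val y)
    (cvxX t (valP x) (valP y)).

Let sub (p : X * X) : E := set_val p.1 - set_val p.2.

Let sub_continuous : continuous sub.
Proof.
move=> p; apply: (@continuous_comp _ _ _
  (fun p : X * X => (set_val p.1, set_val p.2)) (fun q : E * E => q.1 - q.2));
  last exact: sub_continuous.
by apply: cvg_pair => /=; apply: continuous_comp;
  [exact: cvg_fst|exact: initial_continuous|exact: cvg_snd|exact: initial_continuous].
Qed.

Let cptXX : compact [set: X * X].
Proof. by rewrite -setXTT; apply: compact_setX; exact: set_type_compact. Qed.

(** On a compact set the differences [x - y] of points that are at least [e]
    apart form a compact set avoiding the origin, hence they avoid a convex
    neighbourhood of it. *)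
Lemma convex_nbhs_metric (M : metricType R) (h : X -> M) (e : R) :
  continuous h -> 0 < e ->
  exists V : set E, [/\ convex_set V, open V, V 0 &
    forall x y : X, V (set_val x - set_val y) -> mdist (h x) (h y) < e].
Proof.
move=> ch e0.
have V0 : \forall v \near (0 : E), forall p : X * X,
    sub p = v -> mdist (h p.1) (h p.2) < e.
  apply: compact_near_forall cptXX _ => -[x y]; have [<-{y}|xy] := pselect (x = y).
    have e20 : 0 < e / 2 by rewrite divr_gt0.
    have hx : \forall a \near x, mdist (h a) (h x) < e / 2.
      have /metricType_numDomainType.cvgrPdist_lt/(_ _ e20) := ch x.
      by apply: filterS => a; rewrite metric_sym.
    exists ([set p | mdist (h p.1) (h x) < e / 2 /\ mdist (h p.2) (h x) < e / 2],
      setT) => /=.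
      split; last exact: filterT.
      by exists ([set a | mdist (h a) (h x) < e / 2],
        [set a | mdist (h a) (h x) < e / 2]).
    move=> [[a b] v] /= [[ax bx] _] _; rewrite (splitr e).
    apply: le_lt_trans (metric_triangle _ (h x) _) _.
    by rewrite ltrD// metric_sym.
  have /eqP : sub (x, y) <> 0 by move/eqP; rewrite subr_eq0 => /eqP /val_inj.
  move: hE; rewrite open_hausdorff => /[apply].
  move=> [[A B] /= [/set_mem Axy /set_mem B0] [oA oB /eqP AB]].
  exists (sub @^-1` A, B) => /=.
    by split; [apply: sub_continuous|]; apply: open_nbhs_nbhs.
  move=> [p v] /= [Ap Bv] pv; suff : (A `&` B) v by rewrite AB.
  by split => //; rewrite -pv.
have [B cB [oB /(_ 0 _ V0) [V [BV VV0] VV]]] := @locally_convex R E.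
exists V; split => //; [exact: cB (mem_set BV)|exact: oB|].
by move=> x y Vxy; exact: (VV _ Vxy (x, y)).
Qed.

(** Compactness makes [X] bounded: a multiple of any neighbourhood of the origin
    contains all differences of points of [X]. *)
Lemma absorb_sub (V : set E) : nbhs 0 V ->
  exists2 s : R, 0 < s & forall x y : X, V (s *: (set_val x - set_val y)).
Proof.
move=> V0.
have S : \forall s \near (0 : R^o), forall p, V (s *: sub p).
  apply: (compact_near_forall (P := fun (s : R^o) p => V (s *: sub p))
    (nbhs_filter (0 : R^o)) cptXX) => p.
  have := @scale_continuous R E (0, sub p) V.
  rewrite /= scale0r => /(_ V0) [[P Q] /= [P0 Qp] PQ].
  exists (sub @^-1` Q, P); first by split => //; exact: sub_continuous.
  by move=> -[q s] /= [Qq Ps]; exact: (PQ (s, sub q)).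
have [e /= e0 eS] := S.
exists (e / 2); first by rewrite divr_gt0.
move=> x y; apply: (eS _ _ (x, y)); rewrite /ball_ /= sub0r normrN gtr0_norm.
  by rewrite ltr_pdivrMr// ltr_pMr// ltr1n.
by rewrite divr_gt0.
Qed.

(** The metric is the Minkowski functional of an intersection [W] of multiples
    of convex neighbourhoods of the origin, one for each scale [n.+1%:R^-1] of
    the given metric. The factor [n.+1%:R] makes all but finitely many of the
    conditions defining [e *: W] void on [X], so that the metric is continuous
    although [W] need not be a neighbourhood of the origin. *)
Lemma exists_convex_metric : metrizable R X ->
  exists d : X -> X -> R, convex_metric conv_set d.
Proof.
move=> [M [h [g [hK _ ch _]]]].
have Vs (n : nat) : exists Vs : set E * R,
    [/\ convex_set Vs.1, open Vs.1, Vs.1 0,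
        forall x y : X, Vs.1 (set_val x - set_val y) ->
          mdist (h x) (h y) < n.+1%:R^-1 &
        0 < Vs.2 /\ forall x y : X, Vs.1 (Vs.2 *: (set_val x - set_val y))].
  have [|V [cV oV V0 VM]] := @convex_nbhs_metric M h n.+1%:R^-1 ch.
    by rewrite invr_gt0.
  have [s s0 Vs] := absorb_sub (open_nbhs_nbhs (conj oV V0)).
  by exists (V, s).
have {Vs} [Vs VsP] := choice Vs; pose V n := (Vs n).1; pose s n := (Vs n).2.
have s_gt0 n : 0 < s n by have [_ _ _ _ []] := VsP n.
have sV n x y : V n (s n *: sub (x, y)) by have [_ _ _ _ [_]] := VsP n; exact.
pose r n := s n / n.+1%:R.
have r_gt0 n : 0 < r n by rewrite divr_gt0.
pose W : set E := [set v | forall n, V n (r n *: v) /\ V n (r n *: (- v))].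
have cW : convex_set (W : set (convex_lmodType E)).
  move=> u v t /set_mem Wu /set_mem Wv; apply/mem_set => n.
  have [Vu Vu'] := Wu n; have [Vv Vv'] := Wv n; have [cV _ _ _ _] := VsP n.
  have t0 : 0 <= t%:num by []. have t1 : t%:num <= 1 by [].
  have rD (x y : E) : r n *: (t%:num *: x + (1 - t%:num) *: y) =
      t%:num *: (r n *: x) + (1 - t%:num) *: (r n *: y).
    by rewrite scalerDr !scalerA ![_ * r n]mulrC.
  have -> : (u : convex_lmodType E) <| t |> v = t%:num *: u + (1 - t%:num) *: v.
    by [].
  by split; rewrite ?opprD -?scalerN rD; exact: convex_setE.
have W0 : W 0.
  by move=> n; have [_ _ V0 _ _] := VsP n; rewrite oppr0 scaler0.
have scaleV n (a : R) (v : E) : 0 <= a -> a <= 1 -> V n v -> V n (a *: v).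
  by have [cV _ V0 _ _] := VsP n => a0 a1 Vv; exact: convex_set0Z.
have subN x y : - sub (x, y) = sub (y, x) by rewrite /sub /= opprB.
have Wsub x y : W (sub (x, y)).
  move=> n; rewrite subN; have rs u : r n *: u = n.+1%:R^-1 *: (s n *: u).
    by rewrite scalerA mulrC.
  by rewrite !rs; split; apply: scaleV => //; rewrite ?invr_ge0// invf_le1// ler1n.
have WN v : W v -> W (- v) by move=> Wv n; rewrite opprK; have [] := Wv n.
pose d (x y : X) := gauge W (sub (x, y)).
have small x (e : R) : 0 < e -> \forall y \near x, d y x <= e.
  move=> e0.
  (* Only the finitely many [n] with [n.+1%:R < e^-1] constrain [y]. *)
  have far n y y' : e^-1 <= n.+1%:R -> V n (r n *: (e^-1 *: sub (y, y'))).
    move=> ne; have -> : r n *: (e^-1 *: sub (y, y')) =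
        (e^-1 / n.+1%:R) *: (s n *: sub (y, y')).
      by rewrite !scalerA /r; congr (_ *: _); ring.
    apply: scaleV => //; first by rewrite divr_ge0// invr_ge0 ltW.
    by rewrite ler_pdivrMr ?mul1r.
  have near_n n : \forall y \near x, V n (r n *: (e^-1 *: sub (y, x))) /\
      V n (r n *: (e^-1 *: sub (x, y))).
    have [_ oV V0 _ _] := VsP n.
    have := @scale_continuous R E (r n / e, sub (x, x)) (V n).
    rewrite /= /sub subrr scaler0 => /(_ (open_nbhs_nbhs (conj oV V0))).
    move=> [[P Q] /= [Pr Q0] PQ].
    have [|[A B] /= [Ax Bx] AB] := @sub_continuous (x, x) Q.
      by rewrite /sub subrr.
    have V_of p : Q (sub p) -> V n (r n *: (e^-1 *: sub p)).
      move=> Qp; rewrite scalerA; apply: (PQ (r n / e, sub p)); split => //.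
      exact: nbhs_singleton.
    apply: filterS (filterI Ax Bx) => y [Ay By].
    have Ax' := nbhs_singleton Ax; have Bx' := nbhs_singleton Bx.
    by split; [exact: (V_of (y, x) (AB (y, x) _))|exact: (V_of (x, y) (AB (x, y) _))].
  have [N eN] : exists N : nat, e^-1 <= N%:R.
    by exists (Num.bound e^-1); rewrite ltW// archi_boundP// invr_ge0 ltW.
  have := near_finite_forall (P := fun n y => V n (r n *: (e^-1 *: sub (y, x))) /\
    V n (r n *: (e^-1 *: sub (x, y))))
    (nbhs_filter x) (finite_II N) (fun n _ => near_n n).
  apply: filterS => y Vy; apply: gauge_le => // n.
  rewrite -scalerN subN; have [nN|Nn] := ltnP n N; first exact: Vy.
  have en : e^-1 <= n.+1%:R by rewrite (le_trans eN)// ler_nat ltnW.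
  by split; exact: far.
have d_ge0 x y : 0 <= d x y by exact: gauge_ge0.
have dxx x : d x x = 0.
  apply/eqP; rewrite eq_le d_ge0 andbT; apply/ler_addgt0Pr => e e0.
  by rewrite add0r; apply: gauge_le => //; rewrite /sub subrr scaler0.
have dsym x y : d x y = d y x.
  rewrite /d /gauge; congr inf; apply/seteqP; split => t [t0 Wt]; split => //.
    by rewrite -subN scalerN; exact: WN.
  by rewrite -subN scalerN; exact: WN.
have dtri y x z : d x z <= d x y + d y z.
  have := @gauge_comb _ _ _ cW W0 1 1 (sub (x, y)) (sub (y, z)) ler01 ler01.
  rewrite !scale1r !mul1r (_ : sub (x, y) + sub (y, z) = sub (x, z)).
    by apply; [exact: addr_gt0|exact: Wsub|exact: Wsub].
  by rewrite /sub /= addrA subrK.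
exists d; split => //.
- move=> x y dxy; apply: (can_inj hK); apply: mdist_positivity.
  apply/eqP; rewrite eq_le mdist_ge0 andbT; apply/ler_addgt0Pr => e e0.
  rewrite add0r.
  have [n ne] : exists n : nat, n.+1%:R^-1 < e.
    exists (Num.bound e^-1); rewrite invf_plt ?posrE//.
    by rewrite (lt_trans (archi_boundP _)) ?ltr_nat// invr_ge0 ltW.
  apply/ltW/(lt_trans _ ne).
  have [_ _ _ + _] := VsP n; apply.
  have [|_ /(_ n)[]] := @gauge_lt _ _ _ cW W0 (sub (x, y)) (r n) (Wsub _ _).
    by rewrite -/(d x y) dxy.
  by rewrite scalerA divff ?gt_eqF// scale1r.
- move=> [x y]; apply/cvgrPdist_le => e e0 /=.
  have e20 : 0 < e / 2 by rewrite divr_gt0.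
  exists ([set a | d a x <= e / 2], [set b | d b y <= e / 2]) => /=.
    by split; exact: small.
  move=> [a b] /= [ax By].
  have := dtri a x y; have := dtri b a y; have := dtri x a b; have := dtri y x b.
  rewrite (dsym x a) (dsym y b) ler_norml; lra.
- move=> t x y a b; rewrite /d.
  have -> : sub (conv_set t x y, conv_set t a b) =
      t%:num *: sub (x, a) + (1 - t%:num) *: sub (y, b).
    by rewrite /sub /= !scalerBr opprD addrACA.
  by apply: gauge_comb => //; rewrite addrC subrK.
Qed.

End convex_metric_exists.

Section convex_connected.
Context {R : realType} {E : tvsType R} {X : set E}.
Hypothesis cvxX : convex_set X.

(** Along the segment from [x0] to [x1], parametrized by the whole line so that
    connectedness of the line applies, a clopen set cannot be left. *)
Lemma convex_set_clopen (C : set X) : clopen C -> C !=set0 -> C = [set: X].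
Proof.
move=> clC [x0 Cx0]; apply/seteqP; split => // x1 _.
pose clip (t : R) : R^o := Num.min 1 (Num.max 0 t).
have clip_continuous : continuous clip.
  move=> t; apply: (@continuous_min R R (fun=> 1) (Num.max 0)); first exact: cvg_cst.
  by apply: (@continuous_max R R (fun=> 0) id); [exact: cvg_cst|exact: cvg_id].
have clip01 t : (0 <= clip t) && (clip t <= 1).
  by rewrite /clip le_min ler01 le_max lexx /= ge_min lexx.
have clip_ge0 t : 0 <= clip t by have /andP[] := clip01 t.
have clip_le1 t : clip t <= 1 by have /andP[] := clip01 t.
pose path (t : R) : X := conv_set cvxX (Itv01 (clip_ge0 t) (clip_le1 t)) x1 x0.
have path_val t : set_val (path t) =
    set_val x0 + clip t *: (set_val x1 - set_val x0).
  transitivity (clip t *: (set_val x1 : E) + (1 - clip t) *: (set_val x0 : E)).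
    by [].
  by rewrite scalerBl scale1r scalerBr addrCA.
have path_continuous : continuous path.
  move=> t; apply: set_type_continuous => Q; rewrite /= path_val => Qt.
  have [[A B] /= [Ax0 BZ] AB] := @add_continuous E (_, _) Q Qt.
  have [[P D] /= [Pt Dx] PD] := @scale_continuous R E (_, _) B BZ.
  have : nbhs t (clip @^-1` P) by exact: clip_continuous.
  apply: filterS => s Ps; rewrite /= path_val.
  apply: (AB (_, _)); split => /=; first exact: nbhs_singleton.
  by apply: (PD (_, _)); split => //=; exact: nbhs_singleton.
have /clopen_separatedP sep := preimage_clopen clC path_continuous.
have [||C1|C1] := connected_subset (C := setT) sep.
- by move=> t _; exact: lem.
- by apply/connected_intervalP.
- have := C1 1 I; rewrite /preimage /= (_ : path 1 = x1)//.
  apply: val_inj; rewrite -[LHS]/(set_val (path 1)) path_val /clip.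
  by rewrite max_r ?ler01// minxx scale1r addrCA subrr addr0.
- have := C1 0 I; rewrite /setC /preimage /= (_ : path 0 = x0)//.
  apply: val_inj; rewrite -[LHS]/(set_val (path 0)) path_val /clip.
  by rewrite maxxx min_r ?ler01// scale0r addr0.
Qed.

End convex_connected.

(** * Distance functions and convex minorants *)

Section convex_metric_theory.
Context {R : realType} {T : topologicalType} {c : {i01 R} -> T -> T -> T}.
Context {d : T -> T -> R} (dP : convex_metric c d) (cptT : compact [set: T]).
Implicit Types (x y : T) (A : set T) (k g : T -> R).

Let dxx x : d x x = 0. Proof. exact: cmetricxx dP x. Qed.
Let dsym x y : d x y = d y x. Proof. exact: cmetric_sym dP x y. Qed.
Let dtri y x z : d x z <= d x y + d y z.
Proof. exact: cmetric_triangle dP y x z. Qed.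

Lemma cmetric_ge0 x y : 0 <= d x y.
Proof. by have := dtri y x x; rewrite dxx (dsym y x); lra. Qed.

Lemma near_cmetric x (e : R) : 0 < e -> \forall y \near x, d x y < e.
Proof.
move=> e0; have /cvgrPdist_lt/(_ e e0) := @cmetric_continuous _ _ _ _ dP (x, x).
move=> [[P Q] /= [Px Qx] PQ]; apply: filterS Qx => y Qy.
have := PQ (x, y) (conj (nbhs_singleton Px) Qy).
by rewrite /= dxx sub0r normrN ger0_norm ?cmetric_ge0.
Qed.

Lemma cmetric_hausdorff : hausdorff_space T.
Proof.
move=> x y xy; apply: cmetric_eq0 dP _ _ _; apply/eqP.
rewrite eq_le cmetric_ge0 andbT; apply/ler_addgt0Pr => e e0; rewrite add0r.
have e20 : 0 < e / 2 by rewrite divr_gt0.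
have [z [xz yz]] := xy _ _ (near_cmetric x e20) (near_cmetric y e20).
by have := dtri z x y; rewrite /= in xz yz; rewrite (dsym z y); lra.
Qed.

(** A compact topology is minimal among the Hausdorff ones, so a continuous
    metric induces it. *)
Lemma cmetric_nbhs x (O : set T) : open O -> O x ->
  exists2 e : R, 0 < e & forall y, d x y < e -> O y.
Proof.
move=> oO Ox.
have : \forall e \near (0 : R), forall y, d x y < e -> O y.
  apply: (compact_near_forall (P := fun e y => d x y < e -> O y)
    (nbhs_filter (0 : R)) cptT) => y.
  have [->|yx] := pselect (y = x).
    exists (O, setT) => //=; first by split; [exact: open_nbhs_nbhs|exact: filterT].
    by move=> [y' e] /= [].
  have dxy : 0 < d x y / 2.
    rewrite divr_gt0// lt_neqAle cmetric_ge0 andbT eq_sym; apply/eqP => /(cmetric_eq0 dP).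
    by move=> xy; exact: yx.
  exists ([set y' | d y y' < d x y / 2], [set e | e < d x y / 2]) => /=.
    by split; [exact: near_cmetric|exact: lt_nbhsl].
  move=> [y' e] /= [yy' ed] xy'; exfalso.
  by have := dtri y' x y; rewrite (dsym y' y); lra.
move=> [e /= e0 eO]; exists (e / 2); first by rewrite divr_gt0.
apply: eO; rewrite /ball_ /= sub0r normrN gtr0_norm ?divr_gt0//.
by rewrite ltr_pdivrMr// ltr_pMr// ltr1n.
Qed.

Lemma closed_cmetric_ball x e : closed [set y | d x y <= e].
Proof.
rewrite (_ : [set y | _] = ~` [set y | e < d x y]); last first.
  by apply/seteqP; split => y /=; rewrite leNgt => /negP.
apply: open_closedC; rewrite openE => y /= ey.
have r0 : 0 < d x y - e by rewrite subr_gt0.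
apply: filterS (near_cmetric y r0) => y' yy' /=.
by have := dtri y' x y; rewrite (dsym y' y); lra.
Qed.

Lemma cmetric_bounded : exists2 M, 0 < M & forall x y, d x y <= M.
Proof.
have [x0|T0] := pselect (exists x : T, True); last first.
  by exists 1 => // x; exfalso; apply: T0; exists x.
have [x0' _] := x0.
have [p _ pM] := @compact_EVT_max _ R (fun p : T * T => d p.1 p.2) [set: T * T]
  (ex_intro _ (x0', x0') I) ltac:(by rewrite -setXTT; apply: compact_setX)
  (continuous_subspaceT (cmetric_continuous dP)).
exists (d p.1 p.2 + 1); first by rewrite ltr_wpDl// cmetric_ge0.
by move=> x y; rewrite (le_trans (pM (x, y) _))// ?inE// lerDl.
Qed.

Definition conv_closed A := forall t x y, A x -> A y -> A (c t x y).

(** Convex 1-Lipschitz functions: the class contains the distance functions to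
    convex sets, its sublevel sets are closed and convex, and it is stable under
    suprema. *)
Definition convex_lip k :=
  (forall x y, k x <= k y + d x y) /\
  (forall t x y, k (c t x y) <= t%:num * k x + (1 - t%:num) * k y).

Lemma convex_lip_continuous k : convex_lip k -> continuous k.
Proof.
move=> [kl _] x; apply/cvgrPdist_lt => e e0.
apply: filterS (near_cmetric x e0) => y xy.
by have := kl x y; have := kl y x; rewrite (dsym y x) ltr_norml; lra.
Qed.

Definition dist A x : R := inf [set d x a | a in A].

Let dist_lb A x : has_lbound [set d x a | a in A].
Proof. by exists 0 => _ [a _ <-]; exact: cmetric_ge0. Qed.

Lemma dist_le A x a : A a -> dist A x <= d x a.
Proof. by move=> Aa; apply: ge_inf => //; exists a. Qed.

Lemma dist_ge0 A x : 0 <= dist A x.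
Proof.
rewrite /dist; have [->|/set0P A0] := eqVneq [set d x a | a in A] set0.
  by rewrite inf0.
by apply: lb_le_inf => // _ [a _ <-]; exact: cmetric_ge0.
Qed.

Lemma dist_lt A x e : A !=set0 -> dist A x < e -> exists2 a, A a & d x a < e.
Proof.
move=> [a Aa] /inf_lt[|_ [b Ab <-] be]; last by exists b.
by exists (d x a); exists a.
Qed.

Lemma dist_in A a : A a -> dist A a = 0.
Proof.
by move=> Aa; apply/eqP; rewrite eq_le dist_ge0 andbT -(dxx a) dist_le.
Qed.

Lemma dist0_closed A x : A !=set0 -> closed A -> dist A x <= 0 -> A x.
Proof.
move=> A0 cA Ax; apply: contrapT => nAx.
have [e e0 eA] := cmetric_nbhs (closed_openC cA) nAx.
have [a Aa /eA] := dist_lt A0 (le_lt_trans Ax e0); exact.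
Qed.

Lemma dist_convex_lip A : A !=set0 -> conv_closed A -> convex_lip (dist A).
Proof.
move=> A0 cA; split => [x y|t x y]; apply/ler_addgt0Pr => e e0.
  have [|a Aa ya] := @dist_lt A y (dist A y + e) A0; first by rewrite ltrDl.
  by have := dtri y x a; have := dist_le x Aa; lra.
have [|a Aa xa] := @dist_lt A x (dist A x + e) A0; first by rewrite ltrDl.
have [|b Ab yb] := @dist_lt A y (dist A y + e) A0; first by rewrite ltrDl.
have t0 : 0 <= t%:num by []. have t1 : 0 <= 1 - t%:num by rewrite subr_ge0.
have := dist_le (c t x y) (cA t a b Aa Ab).
have := cmetric_conv dP t x y a b.
have := ler_wpM2l t0 (ltW xa); have := ler_wpM2l t1 (ltW yb).
rewrite /= !mulrDr mulrBl mul1r; lra.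
Qed.

(** Being a supremum, it is itself convex and 1-Lipschitz as soon as [g] is
    bounded below. *)
Definition convex_minorant g x : R :=
  sup [set k x | k in [set k | convex_lip k /\ forall u, k u <= g u]].

Section bounded.
Context {M : R} (g : T -> R) (gM : forall x, - M <= g x).

Let minorants := [set k | convex_lip k /\ forall u, k u <= g u].

Let minorant0 x : [set k x | k in minorants] !=set0.
Proof.
exists (- M); exists (fun=> - M) => //; split => //; split => [u v|t u v].
  by rewrite lerDl cmetric_ge0.
by rewrite -mulrDl addrC subrK mul1r.
Qed.

Let minorant_ub x : has_ubound [set k x | k in minorants].
Proof. by exists (g x) => _ [k [_ kg] <-]. Qed.

Lemma convex_minorant_ge k x : convex_lip k -> (forall u, k u <= g u) ->
  k x <= convex_minorant g x.
Proof. by move=> kl kg; apply: ub_le_sup => //; exists k. Qed.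

Lemma convex_minorant_le x : convex_minorant g x <= g x.
Proof. by apply: ge_sup => // _ [k [_ kg] <-]. Qed.

Lemma convex_minorant_lip : convex_lip (convex_minorant g).
Proof.
split => [x y|t x y]; apply: ge_sup => // _ [k [kl kg] <-].
  by have := convex_minorant_ge y kl kg; have [+ _] := kl => /(_ x y); lra.
have t0 : 0 <= t%:num by []. have t1 : 0 <= 1 - t%:num by rewrite subr_ge0.
have [_ kc] := kl; apply: le_trans (kc t x y) _.
by apply: lerD; apply: ler_wpM2l => //; exact: convex_minorant_ge.
Qed.

End bounded.

Lemma convex_minorant_id k : convex_lip k -> convex_minorant k = k.
Proof.
move=> kl; apply/funext => x; apply/eqP; rewrite eq_le convex_minorant_ge// andbT.
by apply: ge_sup => [|_ [k' [_ k'k] <-]] //; exists (k x); exists k.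
Qed.

(** Lowering a minorant of [g] by [e] gives a minorant of [g'], so passing to the
    largest minorant is nonexpansive for the sup-norm. *)
Lemma convex_minorant_near M g g' e x : (forall u, - M <= g' u) ->
  (forall u, - M <= g u) ->
  (forall u, `|g u - g' u| <= e) ->
  `|convex_minorant g x - convex_minorant g' x| <= e.
Proof.
move=> g'M gM gg'.
have half g1 g2 : (forall u, - M <= g1 u) -> (forall u, `|g1 u - g2 u| <= e) ->
    convex_minorant g1 x <= convex_minorant g2 x + e.
  move=> g1M g12; rewrite -lerBlDr.
  apply: (convex_minorant_ge (k := fun u => convex_minorant g1 u - e)) => [|u].
    have [hl hc] := convex_minorant_lip g1M; split => [u v|t u v].
      by have := hl u v; lra.
    have := hc t u v; rewrite !mulrBr mulrBl mul1r; lra.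
  by have := convex_minorant_le g1M u; have := g12 u; rewrite ler_norml; lra.
have := half _ _ gM gg'; have := half g' g g'M.
move=> /(_ (fun u => ltac:(by rewrite distrC)))/= H1 H2.
by rewrite ler_norml; lra.
Qed.

End convex_metric_theory.

Arguments dist {R T} d A x.
Arguments convex_lip {R T} c d k.
Arguments conv_closed {R T} c A.
Arguments convex_minorant {R T} c d g x.

(** * Extension of families of convex sets *)

Section extension.
Context {R : realType} {T : topologicalType} {c : {i01 R} -> T -> T -> T}.
Context {d : T -> T -> R} (dP : convex_metric c d) (cptT : compact [set: T]).
Context {Z : topologicalType} (pZ : paracompact_space Z).

(** Two sets that are [e]-close for the Hausdorff distance have distance
    functions that differ by at most [e] everywhere. *)
Lemma near_dist (A : hyperspace T) (e : R) : 0 < e ->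
  \forall B \near A, forall x, `|dist d (hyperspace_set B) x - dist d A x| <= e.
Proof.
move=> e0.
have half (P Q : hyperspace T) x :
    (forall x, hyperspace_set P x -> exists2 y, hyperspace_set Q y & d x y <= e) ->
    dist d Q x <= dist d P x + e.
  move=> PQ; apply/ler_addgt0Pr => r r0.
  have [|p Pp xp] := @dist_lt _ _ d P x (dist d P x + r) (hyperspace_neq0 P).
    by rewrite ltrDl.
  have [q Qq pq] := PQ p Pp.
  have := dist_le dP x Qq; have := cmetric_triangle dP p x q; lra.
apply: filterS (near_hyperspace_rel (r := fun x y => d x y <= e) _ _) => [B [AB BA] x|x].
  have := half _ _ x AB; have := half B A x; rewrite ler_norml => HBA.
  have {}HBA : dist d A x <= dist d B x + e.
    by apply: HBA => b /BA[a Aa ab]; exists a; rewrite // (cmetric_sym dP).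
  by move: HBA; lra.
exists [set y | d x y < e / 2]; split.
  by apply: (near_cmetric dP); rewrite divr_gt0.
move=> y y' /= xy xy'; have := cmetric_triangle dP x y y'.
by rewrite (cmetric_sym dP y x); lra.
Qed.

(** The distance functions to the given sets extend to the whole of [Z] by
    Tietze's theorem on the normal space [Z * T]; passing to convex minorants
    restores convexity. *)
Lemma extend_dist (A : set Z) (psi : A -> hyperspace T) :
  closed A -> continuous psi -> (forall a, conv_closed c (psi a)) ->
  exists k : Z -> T -> R,
    [/\ forall z, convex_lip c d (k z),
        forall z e, 0 < e -> \forall w \near z, forall x, `|k w x - k z x| <= e
      & forall a x, k (set_val a) x = dist d (psi a) x].
Proof.
move=> cA cpsi vpsi.
have hT := cmetric_hausdorff dP.
have normalZT : normal_space (Z * T)%type.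
  exact/(paracompact_normal R)/paracompact_prod_compact.
have [M M0 dM] := cmetric_bounded dP cptT.
pose g0 (p : Z * T) : R^o :=
  if pselect (A p.1) is left h then dist d (psi (exist _ p.1 (mem_set h))) p.2
  else 0.
have g0E a x : g0 (set_val a, x) = dist d (psi a) x.
  rewrite /g0 /=; case: pselect => [h|[]]; last exact: set_valP.
  by congr (dist d (psi _) x); exact: val_inj.
have g0M p : (A `*` setT) p -> `|g0 p| <= M.
  case: p => z x [/= Az _]; rewrite -[z]/(set_val (exist _ z (mem_set Az) : A)).
  rewrite g0E ger0_norm; last exact: dist_ge0 dP _ _.
  have [b pb] := hyperspace_neq0 (psi (exist _ z (mem_set Az))).
  exact: le_trans (dist_le dP _ pb) (dM _ _).
have g0c : {within A `*` [set: T], continuous g0}.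
  apply/subspace_sigL_continuousP => p.
  apply/(@cvgrPdist_le _ _ _ (nbhs p) (nbhs_filter p)) => e e0.
  have pA : A (set_val p).1 by have [] := set_valP p.
  pose a : A := exist _ (set_val p).1 (mem_set pA).
  have e20 : 0 < e / 2 by rewrite divr_gt0.
  have /cpsi/set_type_nbhs[Q Qa QP] := near_dist (psi a) e20.
  apply/set_type_nbhs.
  exists (Q `*` [set y | d (set_val p).2 y < e / 2]).
    exists (Q, [set y | d (set_val p).2 y < e / 2]) => //=.
    by split => //; exact: (near_cmetric dP _ e20).
  move=> q [/= Qq dq]; have qA : A (set_val q).1 by have [] := set_valP q.
  pose b : A := exist _ (set_val q).1 (mem_set qA).
  have -> : g0 (set_val p) = dist d (psi a) (set_val p).2.
    by rewrite -g0E {1}(surjective_pairing (set_val p)).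
  have -> : g0 (set_val q) = dist d (psi b) (set_val q).2.
    by rewrite -g0E {1}(surjective_pairing (set_val q)).
  have := QP b Qq (set_val q).2.
  have [lip _] := dist_convex_lip dP (hyperspace_neq0 (psi a)) (vpsi a).
  have := lip (set_val p).2 (set_val q).2; have := lip (set_val q).2 (set_val p).2.
  rewrite (cmetric_sym dP (set_val q).2) !ler_norml; lra.
have cAT : closed (A `*` [set: T]).
  rewrite (_ : A `*` _ = fst @^-1` A); first by
    apply: preimage_closed cA => p _; exact: cvg_fst.
  by apply/seteqP; split => [p []|p Ap].
have [g [gE cg gM]] := continuous_bounded_extension normalZT cAT M0 g0c g0M.
have gM' z x : - M <= g (z, x) by have := gM (z, x); rewrite ler_norml => /andP[].
exists (fun z => convex_minorant c d (fun x => g (z, x))); split.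
- by move=> z; apply: convex_minorant_lip.
- move=> z e e0.
  have : \forall w \near z, forall x, `|g (w, x) - g (z, x)| <= e.
    apply: (compact_near_forall (P := fun w x => `|g (w, x) - g (z, x)| <= e)
      (nbhs_filter z) cptT) => x.
    have e20 : 0 < e / 2 by rewrite divr_gt0.
    have /cvgrPdist_le/(_ _ e20)[[P Q] /= [Pz Qx] PQ] := cg (z, x).
    exists (Q, P) => // -[y w] /= [Qy Pw].
    have := PQ (w, y) (conj Pw Qy).
    have := PQ (z, y) (conj (nbhs_singleton Pz) Qy).
    by rewrite !ler_norml /=; lra.
  by apply: filterS => w gw x; exact: (convex_minorant_near dP _ (M := M)).
- move=> a x; have -> : (fun x => g (set_val a, x)) = dist d (psi a).
    apply/funext => y; rewrite -g0E gE// inE; split => //; exact: set_valP.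
  have lip := dist_convex_lip dP (hyperspace_neq0 (psi a)) (vpsi a).
  by rewrite (convex_minorant_id lip).
Qed.

End extension.

(** * Fibres of an open affine map *)

Section fibres.
Context {R : realType} {T U : topologicalType}.
Context {c : {i01 R} -> T -> T -> T} {c' : {i01 R} -> U -> U -> U}.
Context {d : T -> T -> R} (dP : convex_metric c d) (cptT : compact [set: T]).
Context (hU : hausdorff_space U) {f : T -> U} (cf : continuous f).
Context (openf : open_map f) (sf : forall y, exists x, f x = y).
Context (af : forall t x y, f (c t x y) = c' t (f x) (f y)).

Definition fibre_close (e : R) (y y' : U) :=
  forall x, f x = y -> exists2 x', f x' = y' & d x x' <= e.

Lemma closed_fibre y : closed (f @^-1` [set y]).
Proof.
apply: preimage_closed; first by move=> x _; exact: cf.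
exact/accessible_closed_set1/hausdorff_accessible.
Qed.

Lemma compact_fibre y : compact (f @^-1` [set y]).
Proof. by apply: subclosed_compact cptT _ => //; exact: closed_fibre. Qed.

(** Near [y], every point of the fibre of [y] has close points in the nearby
    fibres because [f] is open, and every point of a nearby fibre is close to
    the fibre of [y] because the domain is compact. *)
Lemma fibre_closeP (y : U) (e : R) : 0 < e ->
  exists V : set U, nbhs y V /\ forall y1 y2, V y1 -> V y2 ->
    fibre_close e y1 y2 /\ fibre_close e y2 y1.
Proof.
move=> e0; have e40 : 0 < e / 4 by rewrite divr_gt0.
have lower : \forall y' \near y, f @^-1` [set y] `<=`
    fun x => exists2 x', f x' = y' & d x x' <= e / 2.
  have /compact_near_coveringP cov := @compact_fibre y.
  apply: (cov _ (nbhs y) (fun y' x => exists2 x', f x' = y' & d x x' <= e / 2)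
    (nbhs_filter y)) => x fx.
  have [N [oN Nx] NB] : exists2 N, open_nbhs x N & N `<=` [set x' | d x x' < e / 4].
    have : nbhs x [set x' | d x x' < e / 4] by exact: (near_cmetric dP _ e40).
    by rewrite nbhsE.
  exists (N, f @` N) => /=.
    split; first exact: open_nbhs_nbhs.
    by apply: open_nbhs_nbhs; split; [exact: openf|exists x].
  move=> [x1 _] /= [Nx1 [x2 Nx2 <-]]; exists x2 => //.
  have := NB _ Nx1; have := NB _ Nx2; have := cmetric_triangle dP x x1 x2.
  by rewrite (cmetric_sym dP x1 x) /=; lra.
have upper : \forall y' \near y, forall x, f x = y' ->
    exists2 x', f x' = y & d x x' <= e / 2.
  apply: (compact_near_forall (P := fun y' x => f x = y' ->
    exists2 x', f x' = y & d x x' <= e / 2) (nbhs_filter y) cptT) => x.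
  have [fx|/eqP fx] := pselect (f x = y).
    exists ([set x' | d x x' < e / 4], setT) => /=.
      by split; [exact: (near_cmetric dP _ e40)|exact: filterT].
    move=> [x1 y'] /= [xx1 _] _; exists x => //.
    by rewrite (cmetric_sym dP); lra.
  move: hU; rewrite open_hausdorff => /(_ _ _ fx).
  move=> [[V W] /= [/set_mem Vfx /set_mem Wy] [oV oW /eqP VW]].
  exists (f @^-1` V, W) => /=.
    by split; [apply: cf; exact: open_nbhs_nbhs|exact: open_nbhs_nbhs].
  move=> [x1 y'] /= [Vx1 Wy'] fx1; exfalso.
  by have : set0 y'; rewrite // -VW; split => //; rewrite -fx1.
exists [set y' | (f @^-1` [set y] `<=`
    fun x => exists2 x', f x' = y' & d x x' <= e / 2) /\
  (forall x, f x = y' -> exists2 x', f x' = y & d x x' <= e / 2)].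
split; first exact: filterI.
have half y1 y2 : (forall x, f x = y1 -> exists2 x', f x' = y & d x x' <= e / 2) ->
    (f @^-1` [set y] `<=` fun x => exists2 x', f x' = y2 & d x x' <= e / 2) ->
    fibre_close e y1 y2.
  move=> u l x /u[x0 fx0 xx0]; have [x1 fx1 x01] := l x0 fx0.
  by exists x1 => //; have := cmetric_triangle dP x0 x x1; lra.
by move=> y1 y2 [l1 u1] [l2 u2]; split; exact: half.
Qed.

Definition fibres_close (e : R) (B B' : set U) :=
  (forall y, B y -> exists2 y', B' y' & fibre_close e y y') /\
  (forall y', B' y' -> exists2 y, B y & fibre_close e y y').

Lemma near_fibres_close (B : hyperspace U) (e : R) : 0 < e ->
  \forall B' \near B, fibres_close e B (hyperspace_set B') /\
    fibres_close e (hyperspace_set B') B.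
Proof.
move=> e0.
apply: filterS (near_hyperspace_rel
  (r := fun y y' => fibre_close e y y' /\ fibre_close e y' y) B _).
  move=> B' [BB' B'B]; split; split.
  - by move=> y /BB'[y' By' []]; exists y'.
  - by move=> y /B'B[y' By' []]; exists y'.
  - by move=> y /B'B[y' By' []]; exists y'.
  - by move=> y /BB'[y' By' []]; exists y'.
by move=> y; exact: fibre_closeP.
Qed.

Lemma closed_over (B : hyperspace U) : closed (f @^-1` B).
Proof.
apply: preimage_closed; first by move=> x _; exact: cf.
exact/(compact_closed hU)/hyperspace_compact.
Qed.

Definition lifts (B : hyperspace U) (A : hyperspace T) :=
  conv_closed c A /\ f @` A = B.

(** The set [A'] is the preimage of [B'] cut down to the closed
    [e]-neighbourhood of [A]. It is convex since the distance to [A] is a convex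
    function; it lies over all of [B'], and [A] is [e]-close to it, because
    fibres over close points are [e]-close. *)
Lemma lifts_transfer (B B' : hyperspace U) (A : hyperspace T) (e : R) :
  conv_closed c' B' -> fibres_close e B B' -> lifts B A ->
  exists2 A', lifts B' A' & forall x, `|dist d A' x - dist d A x| <= e.
Proof.
move=> vB' [BB' B'B] [vA fA].
pose S := [set x | (B' : set U) (f x) /\ dist d A x <= e].
have A0 := hyperspace_neq0 A.
have lipA := dist_convex_lip dP A0 vA.
have AS a : (A : set T) a -> exists2 x, S x & d a x <= e.
  move=> Aa; have [|y' B'y' /(_ a erefl)[x fx ax]] := BB' (f a).
    by rewrite -fA; exists a.
  exists x => //; split; first by rewrite fx.
  by rewrite (le_trans (dist_le dP x Aa))// (cmetric_sym dP).
have S0 : S !=set0 by have [a /AS[x Sx _]] := A0; exists x.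
have cS : compact S.
  apply: subclosed_compact cptT _ => //.
  apply: closedI; first exact: closed_over.
  apply: (@preimage_closed _ _ (dist d A) [set t | t <= e]); last exact: closed_le.
  by move=> x _; exact: (convex_lip_continuous dP lipA).
exists (Hyperspace S0 cS); first split => /=.
- move=> t x y [B'x Ax] [B'y Ay]; split; first by rewrite af; exact: vB'.
  have [_ lc] := lipA; apply: le_trans (lc t x y) _.
  have t0 : 0 <= t%:num by []. have t1 : 0 <= 1 - t%:num by rewrite subr_ge0.
  by have := ler_wpM2l t0 Ax; have := ler_wpM2l t1 Ay; rewrite mulrBl mul1r; lra.
- apply/seteqP; split => [_ [x [B'x _] <-]//|y' B'y'].
  have [y By yy'] := B'B y' B'y'; move: By; rewrite -fA => -[a Aa fa].
  have [x fx ax] := yy' a fa; exists x => //; split; first by rewrite fx.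
  by rewrite (le_trans (dist_le dP x Aa))// (cmetric_sym dP).
- move=> x /=; rewrite ler_norml.
  have SA : dist d S x <= dist d A x + e.
    apply/ler_addgt0Pr => r r0.
    have [|a Aa xa] := @dist_lt _ _ d A x (dist d A x + r) A0; first by rewrite ltrDl.
    have [s Ss as_] := AS a Aa.
    by have := dist_le dP x Ss; have := cmetric_triangle dP a x s; lra.
  have AS' : dist d A x <= dist d S x + e.
    apply/ler_addgt0Pr => r r0.
    have [|s [_ As] xs] := @dist_lt _ _ d S x (dist d S x + r) S0; first by rewrite ltrDl.
    by have [lip _] := lipA; have := lip x s; lra.
  by lra.
Qed.

Lemma lifts_exists (B : hyperspace U) : conv_closed c' B -> exists A, lifts B A.
Proof.
move=> vB; have S0 : f @^-1` B !=set0.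
  have [y By] := hyperspace_neq0 B; have [x fx] := sf y.
  by exists x; rewrite /preimage /= fx.
have cS : compact (f @^-1` B).
  by apply: subclosed_compact cptT _ => //; exact: closed_over.
exists (Hyperspace S0 cS); split => /=.
  by move=> t x y Bx By; rewrite /preimage /= af; exact: vB.
by rewrite image_preimage//; apply/seteqP; split => // y _; have [x] := sf y; exists x.
Qed.

End fibres.

Arguments fibre_close {R T U} d f e y y'.
Arguments fibres_close {R T U} d f e B B'.
Arguments lifts {R T U} c f B A.

(** * Sections over a family of compact convex sets *)

Section selection.
Context {R : realType} {T U : topologicalType}.
Context {c : {i01 R} -> T -> T -> T} {c' : {i01 R} -> U -> U -> U}.
Context {d : T -> T -> R} (dP : convex_metric c d) (cptT : compact [set: T]).
Context (cxx : forall t x, c t x x = x) (c'xx : forall t y, c' t y y = y).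
Context (hU : hausdorff_space U) {f : T -> U} (cf : continuous f).
Context (openf : open_map f) (sf : forall y, exists x, f x = y).
Context (af : forall t x y, f (c t x y) = c' t (f x) (f y)).
Context {Z : topologicalType} {k : Z -> T -> R} {phi : Z -> hyperspace U}.
Hypotheses (klip : forall z, convex_lip c d (k z))
  (knear : forall z (e : R), 0 < e -> \forall w \near z, forall x, `|k w x - k z x| <= e)
  (cphi : continuous phi) (vphi : forall z, conv_closed c' (phi z)).

Let lift z (A : hyperspace T) := lifts c f (phi z) A.

Let defects z := [set t : R | 0 <= t /\
  exists2 A, lift z A & forall x, `|k z x - dist d A x| <= t].

(** The sup-norm distance from [k z] to the distance functions of the convex
    sets lying exactly over [phi z]. *)
Definition defect z : R := inf (defects z).

Let defects_lb z : has_lbound (defects z).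
Proof. by exists 0 => t []. Qed.

Lemma defects_neq0 z : defects z !=set0.
Proof.
have [A zA] := lifts_exists cptT hU cf sf af (@vphi z).
have [x0 A0] := hyperspace_neq0 A.
have [M M0 dM] := cmetric_bounded dP cptT.
have [lip _] := klip z.
exists (`|k z x0| + M + M); split; first by rewrite !addr_ge0// ltW.
exists A => // x.
have dx := le_trans (dist_le dP x A0) (dM _ _); have d0 := dist_ge0 dP A x.
have := lip x x0; have := lip x0 x; have := dM x x0; have := dM x0 x.
have := ler_norm (k z x0); have := ler_norm (- k z x0); rewrite normrN ler_norml; lra.
Qed.

Lemma defect_ge0 z : 0 <= defect z.
Proof. by apply: lb_le_inf => [|t []]//; exact: defects_neq0. Qed.

Lemma defect_le z A t : 0 <= t -> lift z A ->
  (forall x, `|k z x - dist d A x| <= t) -> defect z <= t.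
Proof. by move=> t0 zA At; apply: ge_inf => //; split => //; exists A. Qed.

Lemma defect_lt z t : defect z < t ->
  exists2 A, lift z A & forall x, `|k z x - dist d A x| <= t.
Proof.
move=> /inf_lt[|s [s0 [A zA As]] st]; first exact: defects_neq0.
by exists A => // x; apply: le_trans (As x) (ltW st).
Qed.

(** By [lifts_transfer], convex sets over [phi z] and over [phi w] approximate
    each other when [w] is near [z]. *)
Lemma near_defect z e : 0 < e ->
  \forall w \near z, defect w <= defect z + e /\ defect z <= defect w + e.
Proof.
move=> e0; have e30 : 0 < e / 4 by rewrite divr_gt0.
have half w v : (forall x, `|k w x - k v x| <= e / 4) ->
    fibres_close d f (e / 4) (phi w) (phi v) -> defect v <= defect w + e.
  move=> wv cwv.
  have [|A wA At] := @defect_lt w (defect w + e / 4); first by rewrite ltrDl.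
  have [A' vA' AA'] := lifts_transfer dP cptT hU cf af (@vphi v) cwv wA.
  have w0 := defect_ge0 w.
  apply: defect_le vA' _ => [|x]; first by lra.
  have := wv x; have := At x; have := AA' x; rewrite !ler_norml; lra.
have := cphi (near_fibres_close dP cptT hU cf openf (phi z) e30).
move=> near_phi; near=> w.
have [zw wz] : fibres_close d f (e / 4) (phi z) (phi w) /\ fibres_close d f (e / 4) (phi w) (phi z).
  by near: w.
have kw : forall x, `|k w x - k z x| <= e / 4 by near: w; exact: knear.
by split; apply: half => // x; rewrite distrC.
Unshelve. all: by end_near. Qed.

(** The doubled defect leaves room above the minimum of [k z] on each fibre, so
    that where the defect is positive the constraint has strict solutions. *)
Definition section_set z : set T :=
  [set x | (phi z : set U) (f x) /\ k z x <= 2 * defect z].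

Let k_continuous z : continuous (k z).
Proof. exact: (convex_lip_continuous dP (klip z)). Qed.

(** The infimum in [defect] need not come with an optimal convex set; instead, a
    point of [K] where [k z] is smallest satisfies all the bounds
    [t > defect z] at once. *)
Lemma compact_defect z (K : set T) t0 : compact K -> defect z < t0 ->
  (forall t, defect z < t -> t < t0 -> exists2 x, K x & k z x <= t) ->
  exists2 x, K x & k z x <= defect z.
Proof.
move=> cK zt0 Kt.
have [x0 Kx0 _] : exists2 x, K x & k z x <= (defect z + t0) / 2 by apply: Kt; lra.
have [x /set_mem Kx xmin] := compact_EVT_min (ex_intro _ x0 Kx0) cK
  (continuous_subspaceT (@k_continuous z)).
exists x => //; rewrite leNgt; apply/negP => zx.
pose t := Num.min ((defect z + k z x) / 2) ((defect z + t0) / 2).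
have [||y Ky yt] := Kt t; rewrite /t ?lt_min ?gt_min.
- by apply/andP; split; lra.
- by apply/orP; right; lra.
have := xmin y (mem_set Ky); move: yt; rewrite /t le_min => /andP[]; lra.
Qed.

Lemma section_lift z y : (phi z : set U) y ->
  exists2 x, f x = y & k z x <= defect z.
Proof.
move=> zy; have := @compact_defect z (f @^-1` [set y]) (defect z + 1).
apply; [exact: (compact_fibre cptT hU cf)|by rewrite ltrDl|].
move=> t zt _; have [A [vA fA] At] := defect_lt zt.
move: zy; rewrite -fA => -[a Aa fa]; exists a => //.
by have := At a; rewrite (dist_in dP Aa) subr0 => /ler_normlW.
Qed.

Lemma section_neq0 z : section_set z !=set0.
Proof.
have [y zy] := hyperspace_neq0 (phi z); have [x fx kx] := section_lift zy.
exists x; split; first by rewrite fx.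
by have := defect_ge0 z; lra.
Qed.

Lemma section_compact z : compact (section_set z).
Proof.
apply: subclosed_compact cptT _ => //; apply: closedI.
  exact: (closed_over hU cf).
apply: (@preimage_closed _ _ (k z) [set t | t <= 2 * defect z]); last exact: closed_le.
by move=> x _; exact: k_continuous.
Qed.

Definition section_hyperspace z := Hyperspace (section_neq0 z) (@section_compact z).

Lemma section_lifts z : lift z (section_hyperspace z).
Proof.
split => /= [t x y [fx kx] [fy ky]|].
  split; first by rewrite af; exact: vphi.
  have [_ lc] := klip z; apply: le_trans (lc t x y) _.
  have t0 : 0 <= t%:num by []. have t1 : 0 <= 1 - t%:num by rewrite subr_ge0.
  by have := ler_wpM2l t0 kx; have := ler_wpM2l t1 ky; rewrite mulrBl mul1r; lra.
apply/seteqP; split => [_ [x [zx _] <-]//|y zy].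
have [x fx kx] := section_lift zy; exists x => //; split; first by rewrite fx.
by have := defect_ge0 z; lra.
Qed.

(** The condition defining [section_set] is closed in both variables, and the
    domain is compact. *)
Lemma section_usc z (N : set T) : open N -> section_set z `<=` N ->
  \forall w \near z, section_set w `<=` N.
Proof.
move=> oN zN.
apply: (compact_near_forall (P := fun w x => section_set w x -> N x)
  (nbhs_filter z) cptT) => x.
have [Nx|nNx] := pselect (N x).
  exists (N, setT) => /=; first by split; [exact: open_nbhs_nbhs|exact: filterT].
  by move=> [x' w] /= [].
have [fx|nfx] := pselect ((phi z : set U) (f x)).
  have kx : 2 * defect z < k z x.
    by rewrite ltNge; apply/negP => kx; apply: nNx; apply: zN.
  pose e := (k z x - 2 * defect z) / 5.
  have e0 : 0 < e by rewrite /e divr_gt0// subr_gt0.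
  exists ([set x' | d x x' < e], [set w | (forall x, `|k w x - k z x| <= e) /\
      (defect w <= defect z + e /\ defect z <= defect w + e)]) => /=.
    split; first exact: (near_cmetric dP).
    by apply: filterI; [exact: knear|exact: near_defect].
  move=> [x' w] /= [xx' [kw [wz _]]] [_ kwx']; exfalso.
  have [lip _] := klip z; have := lip x x'; have := kw x'.
  by move: xx' wz kwx'; rewrite ler_norml /e; lra.
have cptU : compact [set: U].
  have -> : [set: U] = f @` [set: T].
    by apply/seteqP; split => // y _; have [x'] := sf y; exists x'.
  by apply: continuous_compact => //; exact: continuous_subspaceT.
have fxV : nbhs (f x) (~` (phi z : set U)).
  apply: open_nbhs_nbhs; split => //; apply/closed_openC/(compact_closed hU).
  exact: hyperspace_compact.
have [V Vx VC] := compact_regular hU cptU filterT fxV.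
have oV : open (~` closure V) by exact/closed_openC/closed_closure.
have zV : (phi z : set U) `<=` ~` closure V.
  by move=> y zy clVy; exact: VC clVy zy.
exists (f @^-1` V, [set w | (phi w : set U) `<=` ~` closure V]) => /=.
  by split; [exact: cf|exact: (cphi (near_hyperspace_sub oV zV))].
by move=> [x' w] /= [Vx' wV] [wx' _]; exfalso; apply: (wV _ wx'); exact: subset_closure.
Qed.

(** Where the defect is positive, [x] can be moved inside its fibre towards a
    strict solution of [k z x < 2 * defect z], which survives small changes
    of [z]. *)
Lemma section_lsc_gt0 z (N : set T) x : open N -> N x -> section_set z x ->
  0 < defect z -> \forall w \near z, section_set w `&` N !=set0.
Proof.
move=> oN Nx [zx kx] z0.
have [r r0 rN] := cmetric_nbhs dP cptT oN Nx.
have [x0 fx0 kx0] := section_lift zx.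
have D0 := cmetric_ge0 dP x0 x.
(* The weight [s] satisfies [s * d x0 x < r], so that [xt] stays in [N]. *)
pose s := r / (r + d x0 x + 1).
have s0 : 0 < s by rewrite divr_gt0//; lra.
have s1 : s <= 1 by rewrite ler_pdivrMr ?mul1r; lra.
have sd : s * d x0 x < r.
  rewrite mulrAC ltr_pdivrMr; last by lra.
  by rewrite ltr_pM2l//; lra.
pose t := Itv01 (ltW s0) s1; pose xt := c t x0 x.
have tE : t%:num = s by [].
have Nxt : N xt.
  apply: rN; rewrite (cmetric_sym dP).
  have := cmetric_conv dP t x0 x x x.
  by rewrite cxx tE (cmetricxx dP) mulr0 addr0 => /le_lt_trans; apply.
have fxt : f xt = f x by rewrite af fx0 c'xx.
have kxt : k z xt <= 2 * defect z - s * defect z.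
  have [_ lc] := klip z; apply: le_trans (lc t x0 x) _; rewrite tE.
  have s1' : 0 <= 1 - s by lra.
  have := ler_wpM2l (ltW s0) kx0; have := ler_wpM2l s1' kx; lra.
pose e := s * defect z / 8.
have e0 : 0 < e by apply: divr_gt0 => //; exact: mulr_gt0.
pose N' := N `&` [set u | k z u < 2 * defect z - 4 * e].
have oN' : open N'.
  apply: openI => //; apply: (@open_comp _ _ (k z) [set u | u < _]).
    by move=> u _; exact: k_continuous.
  exact: open_lt.
have xt' : N' xt.
  split => //; apply: le_lt_trans kxt _; have : s * defect z = 8 * e.
    by rewrite /e; field.
  by move=> ->; lra.
have hit : (phi z : set U) `&` (f @` N') !=set0.
  by exists (f x); split => //; exists xt.
have near_hit := cphi (near_hyperspace_meet (openf oN') hit).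
near=> w.
have kw : forall x, `|k w x - k z x| <= e by near: w; exact: knear.
have [_ zw] : defect w <= defect z + e /\ defect z <= defect w + e.
  by near: w; exact: near_defect.
have [y [wy [u [Nu ku] fu]]] : (phi w : set U) `&` (f @` N') !=set0 by near: w.
exists u; split => //; split; first by rewrite fu.
by have := kw u; rewrite ler_norml /= in ku *; lra.
Unshelve. all: by end_near. Qed.

(** Where the defect vanishes, [k z] is the distance function of
    [section_set z], so the convex sets over [phi w] which nearly realize the
    defect of a nearby [w] pass close to every point of [section_set z]. *)
Lemma section_lsc_eq0 z (N : set T) x : open N -> N x -> section_set z x ->
  defect z = 0 -> \forall w \near z, section_set w `&` N !=set0.
Proof.
move=> oN Nx [zx kx] z0; rewrite z0 mulr0 in kx.
have [r r0 rN] := cmetric_nbhs dP cptT oN Nx.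
pose e := r / 8; have e0 : 0 < e by rewrite divr_gt0.
near=> w.
have kw : forall x, `|k w x - k z x| <= e by near: w; exact: knear.
have [wz _] : defect w <= defect z + e /\ defect z <= defect w + e.
  by near: w; exact: near_defect.
pose K := f @^-1` (phi w : set U) `&` [set u | d x u <= 4 * e].
have cK : compact K.
  apply: subclosed_compact cptT _ => //; apply: closedI.
    exact: (closed_over hU cf).
  exact: closed_cmetric_ball dP _ _.
have [||u [wu xu] ku] := @compact_defect w K (2 * e) cK; first by lra.
  move=> t wt t2e; have [A [vA fA] At] := defect_lt wt.
  have [|a Aa xa] := @dist_lt _ _ d A x (4 * e) (hyperspace_neq0 A).
    by have := At x; have := kw x; rewrite !ler_norml; lra.
  exists a; first by split; [rewrite /preimage /= -fA; exists a|exact: ltW].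
  by have := At a; rewrite (dist_in dP Aa) subr0 => /ler_normlW.
exists u; split; first by split => //; have := defect_ge0 w; lra.
by apply: rN; apply: le_lt_trans xu _; rewrite /e; lra.
Unshelve. all: by end_near. Qed.

Lemma section_continuous : continuous section_hyperspace.
Proof.
move=> z; apply: hyperspace_cvg => N oN; first exact: section_usc.
move=> [x [zx Nx]]; have := defect_ge0 z; rewrite le_eqVlt => /predU1P[z0|z0].
  exact: (section_lsc_eq0 oN Nx zx (esym z0)).
exact: (section_lsc_gt0 oN Nx zx z0).
Qed.

Lemma section_fixed z (A : hyperspace T) : lifts c f (phi z) A ->
  k z = dist d A -> section_hyperspace z = A.
Proof.
move=> zA kA.
have z0 : defect z = 0.
  apply/eqP; rewrite eq_le defect_ge0 andbT; apply: defect_le zA _ => // x.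
  by rewrite kA subrr normr0.
have cA : closed (A : set T).
  by apply: compact_closed (cmetric_hausdorff dP) _; exact: hyperspace_compact.
apply: hyperspace_ext; apply/seteqP; split => x /=.
  move=> [_]; rewrite z0 mulr0 kA.
  exact: (dist0_closed dP cptT (hyperspace_neq0 A) cA).
move=> Ax; split; last by rewrite z0 mulr0 kA (dist_in dP Ax).
by have [_ <-] := zA; exists x.
Qed.

End selection.

(** * Softness *)

Lemma ccP (R : realType) (E : tvsType R) (X : set E) (cvxX : convex_set X)
    (A : hyperspace X) : cc X A <-> conv_closed (conv_set cvxX) (A : set X).
Proof.
split=> [cA t x y Ax Ay|cA _ _ t /set_mem[x Ax <-] /set_mem[y Ay <-]].
  have := cA _ _ t (mem_set (imageP set_val Ax)) (mem_set (imageP set_val Ay)).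
  move=> /set_mem[z Az zE]; suff <- : z = conv_set cvxX t x y by [].
  exact: val_inj.
by apply/mem_set; exists (conv_set cvxX t x y) => //; exact: cA.
Qed.

Lemma conv_setxx (R : realType) (E : tvsType R) (X : set E)
    (cvxX : convex_set X) t (x : X) : conv_set cvxX t x x = x.
Proof. by apply: val_inj; exact: (@convmm _ (convex_lmodType E)). Qed.

Theorem proposition3p1 (R : realType) (E F : tvsType R)
    (hE : hausdorff_space E) (hF : hausdorff_space F)
    (X : set E) (Y : set F)
    (neX : X !=set0) (neY : Y !=set0)
    (cptX : compact X) (cptY : compact Y)
    (cvxX : convex_set X) (cvxY : convex_set Y)
    (mX : metrizable R X) (mY : metrizable R Y)
    (f : X -> Y) (cf : continuous f) (af : affine_map f) (of_ : open_map f) :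
  soft (cc_map cf af).
Proof.
move=> Z A psi phi pZ cA cpsi cphi fpsi.
have [d dP] := exists_convex_metric hE cptX cvxX mX.
have cX := set_type_compact cptX.
have hY := set_type_hausdorff (A := Y) hF.
have fconv t x y : f (conv_set cvxX t x y) = conv_set cvxY t (f x) (f y).
  by apply: val_inj; exact: (af x y (conv_set cvxX t x y) t erefl).
have fT : f @` [set: X] = [set: Y].
  apply: (convex_set_clopen cvxY); last first.
    have [x Xx] := neX; pose x' : X := exist _ x (mem_set Xx).
    by exists (f x'); exists x'.
  split; first by apply: of_; exact: openT.
  apply: (compact_closed hY); apply: continuous_compact => //.
  exact: continuous_subspaceT.
have sf y : exists x, f x = y.
  by have : [set: Y] y by []; rewrite -fT => -[x _ <-]; exists x.
pose psi' a := set_val (psi a); pose phi' z := set_val (phi z).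
have cpsi' : continuous psi'.
  move=> a; apply: continuous_comp; [exact: cpsi|exact: initial_continuous].
have cphi' : continuous phi'.
  move=> z; apply: continuous_comp; [exact: cphi|exact: initial_continuous].
have vpsi a : conv_closed (conv_set cvxX) (psi' a).
  by apply/ccP; exact: set_valP.
have vphi z : conv_closed (conv_set cvxY) (phi' z).
  by apply/ccP; exact: set_valP.
have [k [klip knear kpsi]] := extend_dist dP cX pZ cA cpsi' vpsi.
pose S := section_hyperspace dP cX hY cf sf fconv klip vphi.
have SP z : lifts (conv_set cvxX) f (phi' z) (S z) by exact: section_lifts.
have cS : continuous S.
  exact: (section_continuous (conv_setxx cvxX) (conv_setxx cvxY) of_ knear cphi').
have ccS z : cc X (S z) by have [/(ccP cvxX)] := SP z.
exists (fun z => exist _ (S z) (mem_set (ccS z))); split.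
- move=> z; apply: set_type_continuous; exact: cS.
- apply/funext => a; apply: val_inj => /=.
  apply: section_fixed; last by apply/funext => x; rewrite kpsi.
  split; first exact: vpsi.
  have := congr1 (fun g => set_val (g a)) fpsi; rewrite /= /phi' => <-.
  by [].
- apply/funext => z; apply: val_inj; apply: hyperspace_ext => /=.
  by have [] := SP z.
Qed.
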